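(* Weighted lenses are precisely lenses enriched in the distributive monoidal category $\mathrm{w}\mathcal{S}\mathrm{et}$ of weighted sets. That is, categories enriched in $\mathrm{w}\mathcal{S}\mathrm{et}$ are precisely weighted categories and, under this identification, for all weighted categories $\mathcal{A}$ and $\mathcal{B}$, an enriched lens $\mathcal{A}\rightleftharpoons\mathcal{B}$ with base of enrichment $\mathrm{w}\mathcal{S}\mathrm{et}$ is precisely a weighted lens $\mathcal{A}\rightleftharpoons\mathcal{B}$, namely a delta lens $(F,\Phi)$ between the underlying categories such that $|w|\geq|F_{a,a'}(w)|$ for every morphism $w:a\to a'$ of $\mathcal{A}$, and $|u|\geq|\Phi_{a,b}(u)|$ for every object $a$ of $\mathcal{A}$ and every morphism $u:\Phi a\to b$ of $\mathcal{B}$.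
   Context: **Weighted sets.** $\mathrm{w}\mathcal{S}\mathrm{et}$ is the free coproduct completion $\mathrm{Fam}([0,\infty],\geq)$ of the thin category $([0,\infty],\geq)$ (a unique morphism $x\to y$ exists if and only if $x\geq y$). Its objects are sets $J$ with a weight function $|\cdot|:J\to[0,\infty]$; its morphisms $J\to K$ are functions $f$ with $|j|\geq|f(j)|$ for all $j\in J$. Coproducts are disjoint unions with the evident weights. The monoidal product of $J$ and $K$ is $J\times K$ with $|(j,k)|=|j|+|k|$, and the unit $I$ is a one-element set of weight $0$. This is a distributive monoidal category (the tensor preserves coproducts in each variable). **Weighted categories.** A weighted category is a locally small category $\mathcal{A}$ (with a set of objects) together with a weight $|u|\in[0,\infty]$ for each morphism $u$, such that $0\geq|1_a|$ (equivalently $|1_a|=0$) and $|u|+|v|\geq|v\circ u|$. **Delta lenses.** A cofunctor $\Phi:\mathcal{A}\nrightarrow\mathcal{B}$ between (locally small) categories is a function $\Phi:\mathrm{obj}(\mathcal{A})\to\mathrm{obj}(\mathcal{B})$ with functions $\Phi_{a,b}:\mathcal{B}(\Phi a,b)\to\coprod_{x\in\Phi^{-1}\{b\}}\mathcal{A}(a,x)$ such that $\Phi_{a,\Phi a}(1_{\Phi a})=1_a$ and $\Phi_{a,b'}(v\circ u)=\Phi_{a',b'}(v)\circ\Phi_{a,b}(u)$, where $u:\Phi a\to b$, $v:b\to b'$ and $a'=\mathrm{cod}\,\Phi_{a,b}(u)$. A delta lens $(F,\Phi):\mathcal{A}\rightleftharpoons\mathcal{B}$ is a functor $F:\mathcal{A}\to\mathcal{B}$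 and a cofunctor $\Phi:\mathcal{A}\nrightarrow\mathcal{B}$ with $Fa=\Phi a$ for all $a$ and $F_{a,a'}\Phi_{a,b}(u)=u$ for all $u:\Phi a\to b$, where $a'=\mathrm{cod}\,\Phi_{a,b}(u)$. **Enriched notions**, over a distributive monoidal category $(\mathcal{V},\otimes,I)$ (coproducts $\sum$, injections $\iota_x$, copairings $[f_x]$, canonical isomorphisms $\cong$). An enriched category $\mathcal{A}$ has a set $\mathrm{obj}(\mathcal{A})$, hom-objects $\mathcal{A}(x,y)\in\mathcal{V}$, identities $\eta_x:I\to\mathcal{A}(x,x)$ and composition $\mu_{x,y,z}:\mathcal{A}(x,y)\otimes\mathcal{A}(y,z)\to\mathcal{A}(x,z)$, satisfying the usual laws. An enriched functor $F:\mathcal{A}\to\mathcal{B}$ is a function on objects with morphisms $F_{a,a'}:\mathcal{A}(a,a')\to\mathcal{B}(Fa,Fa')$ preserving identities and composition. An enriched cofunctor $\Phi:\mathcal{A}\nrightarrow\mathcal{B}$ is a function $\Phi:\mathrm{obj}(\mathcal{A})\to\mathrm{obj}(\mathcal{B})$ together with morphisms $\Phi_{a,b}:\mathcal{B}(\Phi a,b)\to\sum_{x\in\Phi^{-1}\{b\}}\mathcal{A}(a,x)$ in $\mathcal{V}$ such that: - (identities) $\Phi_{a,\Phi a}\circ\eta_{\Phi a}=\iota_a\circ\eta_a$; - (composites) with $X=\Phi^{-1}\{b\}$, $Y=\Phi^{-1}\{b'\}$, the morphism $\Phi_{a,b'}\circ\mu_{\Phi a,b,b'}$ equals $\mathcal{B}(\Phi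 a,b)\otimes\mathcal{B}(b,b')\xrightarrow{\Phi_{a,b}\otimes\mathrm{id}}\big(\sum_{x\in X}\mathcal{A}(a,x)\big)\otimes\mathcal{B}(b,b')\cong\sum_{x\in X}\mathcal{A}(a,x)\otimes\mathcal{B}(\Phi x,b')\xrightarrow{\sum\mathrm{id}\otimes\Phi_{x,b'}}\sum_{x\in X}\mathcal{A}(a,x)\otimes\big(\sum_{y\in Y}\mathcal{A}(x,y)\big)\cong\sum_{y\in Y}\sum_{x\in X}\mathcal{A}(a,x)\otimes\mathcal{A}(x,y)\xrightarrow{\sum[\mu_{a,x,y}]}\sum_{y\in Y}\mathcal{A}(a,y)$. An enriched lens $(F,\Phi):\mathcal{A}\rightleftharpoons\mathcal{B}$ is an enriched functor $F:\mathcal{A}\to\mathcal{B}$ and an enriched cofunctor $\Phi:\mathcal{A}\nrightarrow\mathcal{B}$ such that $Fa=\Phi a$ for all $a\in\mathrm{obj}(\mathcal{A})$ and, for all $a,b$, the composite $\mathcal{B}(Fa,b)\xrightarrow{\Phi_{a,b}}\sum_{x\in F^{-1}\{b\}}\mathcal{A}(a,x)\xrightarrow{[F_{a,x}]}\mathcal{B}(Fa,b)$ is the identity. *)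

(* Defs.v *)
From mathcomp Require Import all_boot all_order all_algebra.
From mathcomp Require Import boolp reals constructive_ereal.

Set Implicit Arguments.
Unset Strict Implicit.
Unset Printing Implicit Defensive.
(* Gives definitional eta for the records below. *)
Set Primitive Projections.

Import Order.TTheory GRing.Theory Num.Theory.

(* Composition is written in diagrammatic order: [f ;; g] is g o f. *)
Record cat_struct (O : Type) (H : O -> O -> Type) := CatStruct {
  idm : forall x, H x x;
  cmp : forall x y z, H x y -> H y z -> H x z;
  cmp1m : forall x y (f : H x y), cmp (idm x) f = f;
  cmpm1 : forall x y (f : H x y), cmp f (idm y) = f;
  cmpA : forall x y z t (f : H x y) (g : H y z) (h : H z t),
    cmp f (cmp g h) = cmp (cmp f g) h }.

Declare Scope moncat_scope.
Delimit Scope moncat_scope with V.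
Local Open Scope moncat_scope.

Reserved Notation "f ;; g" (at level 50, left associativity).
Reserved Notation "x \ox y" (at level 40, left associativity).
Reserved Notation "f \oxm g" (at level 40, left associativity).

(* A possibly large category, such as a base of enrichment. It is kept apart
   from [category] below, whose objects form a set, so that the objects of
   wSet and those of a weighted category live in separate universes. *)
Record precat := PreCat {
  vob :> Type;
  vhom : vob -> vob -> Type;
  vcat : cat_struct vhom }.

Definition vid (V : precat) (x : V) : vhom x x := idm (vcat V) x.
Definition vcmp (V : precat) (x y z : V) (f : vhom x y) (g : vhom y z) :
  vhom x z := cmp (vcat V) f g.
Notation "f ;; g" := (vcmp f g) : moncat_scope.

Definition inverse_pair (V : precat) (x y : V) (f : vhom x y) (g : vhom y x) :=
  f ;; g = vid x /\ g ;; f = vid y.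

Definition eq_hom (V : precat) (x y : V) (e : x = y) : vhom x y :=
  ecast z (vhom x z) e (vid x).

Record monoidal_struct (V : precat) := MonoidalStruct {
  tens : V -> V -> V;
  tensm : forall x x' y y' : V,
    vhom x x' -> vhom y y' -> vhom (tens x y) (tens x' y');
  munit : V;
  massoc : forall x y z : V, vhom (tens (tens x y) z) (tens x (tens y z));
  massocV : forall x y z : V, vhom (tens x (tens y z)) (tens (tens x y) z);
  mlunit : forall x : V, vhom (tens munit x) x;
  mlunitV : forall x : V, vhom x (tens munit x);
  mrunit : forall x : V, vhom (tens x munit) x;
  mrunitV : forall x : V, vhom x (tens x munit);
  tensm_id : forall x y : V, tensm (vid x) (vid y) = vid (tens x y);
  tensm_cmp : forall (x x' x'' y y' y'' : V) (f : vhom x x') (f' : vhom x' x'')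
      (g : vhom y y') (g' : vhom y' y''),
    tensm (f ;; f') (g ;; g') = tensm f g ;; tensm f' g';
  massocP : forall x y z : V, inverse_pair (massoc x y z) (massocV x y z);
  mlunitP : forall x : V, inverse_pair (mlunit x) (mlunitV x);
  mrunitP : forall x : V, inverse_pair (mrunit x) (mrunitV x);
  massoc_nat : forall (x x' y y' z z' : V)
      (f : vhom x x') (g : vhom y y') (h : vhom z z'),
    tensm (tensm f g) h ;; massoc x' y' z' =
    massoc x y z ;; tensm f (tensm g h);
  mlunit_nat : forall (x y : V) (f : vhom x y),
    tensm (vid munit) f ;; mlunit y = mlunit x ;; f;
  mrunit_nat : forall (x y : V) (f : vhom x y),
    tensm f (vid munit) ;; mrunit y = mrunit x ;; f;
  mtriangle : forall x y : V,
    massoc x munit y ;; tensm (vid x) (mlunit y) = tensm (mrunit x) (vid y);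
  mpentagon : forall x y z t : V,
    tensm (massoc x y z) (vid t) ;; massoc x (tens y z) t ;;
      tensm (vid x) (massoc y z t) =
    massoc (tens x y) z t ;; massoc x y (tens z t) }.

Record coprod_struct (V : precat) := CoprodStruct {
  coprod : forall J : Type, (J -> V) -> V;
  inj : forall (J : Type) (X : J -> V) (j : J), vhom (X j) (coprod X);
  copair : forall (J : Type) (X : J -> V) (y : V),
    (forall j, vhom (X j) y) -> vhom (coprod X) y;
  inj_copair : forall (J : Type) (X : J -> V) (y : V)
      (f : forall j, vhom (X j) y) (j : J), inj X j ;; copair f = f j;
  copair_uniq : forall (J : Type) (X : J -> V) (y : V)
      (f : forall j, vhom (X j) y) (g : vhom (coprod X) y),
    (forall j, inj X j ;; g = f j) -> g = copair f }.

(* The tensor preserves coproducts in each variable: the canonical comparison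
   morphisms have inverses [distl] and [distr]. *)
Record distr_moncat := DistrMonCat {
  dcat :> precat;
  dmon : monoidal_struct dcat;
  dcop : coprod_struct dcat;
  distl : forall (J : Type) (X : J -> dcat) (y : dcat),
    vhom (tens dmon (coprod dcop X) y)
         (coprod dcop (fun j => tens dmon (X j) y));
  distr : forall (J : Type) (y : dcat) (X : J -> dcat),
    vhom (tens dmon y (coprod dcop X))
         (coprod dcop (fun j => tens dmon y (X j)));
  distlP : forall (J : Type) (X : J -> dcat) (y : dcat),
    inverse_pair (distl X y)
      (copair dcop (fun j => tensm dmon (inj dcop X j) (vid y)));
  distrP : forall (J : Type) (y : dcat) (X : J -> dcat),
    inverse_pair (distr y X)
      (copair dcop (fun j => tensm dmon (vid y) (inj dcop X j))) }.

Notation "x \ox y" := (tens (dmon _) x y) : moncat_scope.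
Notation "f \oxm g" := (tensm (dmon _) f g) : moncat_scope.

Section DistrMonCat.
Variable V : distr_moncat.

Definition dunit : V := munit (dmon V).
Definition csum (J : Type) (X : J -> V) : V := coprod (dcop V) X.
Definition cinj (J : Type) (X : J -> V) (j : J) : vhom (X j) (csum X) :=
  inj (dcop V) X j.
Definition ccopair (J : Type) (X : J -> V) (y : V)
  (f : forall j, vhom (X j) y) : vhom (csum X) y := copair (dcop V) f.
Definition csum_map (J : Type) (X Y : J -> V) (f : forall j, vhom (X j) (Y j)) :
  vhom (csum X) (csum Y) := ccopair (fun j => f j ;; cinj Y j).
Definition csum_swap (J K : Type) (X : J -> K -> V) :
  vhom (csum (fun j => csum (fun k => X j k)))
       (csum (fun k => csum (fun j => X j k))) :=
  ccopair (fun j => ccopair (fun k =>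
    cinj (fun j => X j k) j ;; cinj (fun k => csum (fun j => X j k)) k)).

End DistrMonCat.

Definition fiber (S T : Type) (f : S -> T) (t : T) := {s : S | f s = t}.

Section Enriched.
Variable V : distr_moncat.

Record ecat := ECat {
  eob :> Type;
  ehom : eob -> eob -> V;
  eid : forall x, vhom (dunit V) (ehom x x);
  ecmp : forall x y z, vhom (ehom x y \ox ehom y z) (ehom x z);
  ecmp1m : forall x y,
    (eid x \oxm vid (ehom x y)) ;; ecmp x x y = mlunit (dmon V) (ehom x y);
  ecmpm1 : forall x y,
    (vid (ehom x y) \oxm eid y) ;; ecmp x y y = mrunit (dmon V) (ehom x y);
  ecmpA : forall x y z t,
    (ecmp x y z \oxm vid (ehom z t)) ;; ecmp x z t =
    massoc (dmon V) (ehom x y) (ehom y z) (ehom z t) ;;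
      (vid (ehom x y) \oxm ecmp y z t) ;; ecmp x y t }.

Definition ecast_dom (B : ecat) (b b' c : B) (e : b = b') :
  vhom (ehom b c) (ehom b' c) := eq_hom (congr1 (fun z => ehom z c) e).
Definition ecast_cod (B : ecat) (b c c' : B) (e : c = c') :
  vhom (ehom b c) (ehom b c') := eq_hom (congr1 (fun z => ehom b z) e).

Record efunctor (A B : ecat) := EFunctor {
  ef_ob :> A -> B;
  ef_hom : forall a a', vhom (ehom a a') (ehom (ef_ob a) (ef_ob a'));
  ef_id : forall a, eid a ;; ef_hom a a = eid (ef_ob a);
  ef_cmp : forall a a' a'',
    ecmp a a' a'' ;; ef_hom a a'' =
    (ef_hom a a' \oxm ef_hom a' a'') ;; ecmp (ef_ob a) (ef_ob a') (ef_ob a'') }.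

Definition lift_obj (A B : ecat) (P : A -> B) (a : A) (b : B) : V :=
  csum (fun x : fiber P b => ehom a (sval x)).

(* The right-hand side of the composition law of an enriched cofunctor:
   [lift2_distl] is the first canonical isomorphism, where B(b, b') is
   identified with B(P x, b') for [x] in the fiber of [b]; [lift2_distr] is the
   second one, and [lift2_cmp] is the sum of copairings of compositions. *)
Section Lift2.
Variables (A B : ecat) (P : A -> B).
Variable Phi : forall a b, vhom (ehom (P a) b) (lift_obj P a b).
Variables (a : A) (b b' : B).

Definition lift2_distl :
  vhom (lift_obj P a b \ox ehom b b')
       (csum (fun x : fiber P b => ehom a (sval x) \ox ehom (P (sval x)) b')) :=
  distl _ _ ;;
  csum_map (fun x : fiber P b =>
    vid (ehom a (sval x)) \oxm ecast_dom b' (esym (proj2_sig x))).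

Definition lift2_lift :
  vhom (csum (fun x : fiber P b => ehom a (sval x) \ox ehom (P (sval x)) b'))
       (csum (fun x : fiber P b => ehom a (sval x) \ox lift_obj P (sval x) b'))
  := csum_map (fun x : fiber P b =>
       vid (ehom a (sval x)) \oxm Phi (sval x) b').

Definition lift2_distr :
  vhom (csum (fun x : fiber P b => ehom a (sval x) \ox lift_obj P (sval x) b'))
       (csum (fun y : fiber P b' => csum (fun x : fiber P b =>
          ehom a (sval x) \ox ehom (sval x) (sval y)))) :=
  csum_map (fun x : fiber P b => distr _ _) ;; csum_swap _.

Definition lift2_cmp :
  vhom (csum (fun y : fiber P b' => csum (fun x : fiber P b =>
          ehom a (sval x) \ox ehom (sval x) (sval y))))
       (lift_obj P a b') :=
  csum_map (fun y : fiber P b' =>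
    ccopair (fun x : fiber P b => ecmp a (sval x) (sval y))).

Definition lift2 : vhom (ehom (P a) b \ox ehom b b') (lift_obj P a b') :=
  (Phi a b \oxm vid (ehom b b')) ;;
  lift2_distl ;; lift2_lift ;; lift2_distr ;; lift2_cmp.

End Lift2.

Record ecofunctor (A B : ecat) := ECofunctor {
  ec_ob :> A -> B;
  ec_lift : forall a b, vhom (ehom (ec_ob a) b) (lift_obj ec_ob a b);
  ec_id : forall a,
    eid (ec_ob a) ;; ec_lift a (ec_ob a) =
    eid a ;; cinj (fun x : fiber ec_ob (ec_ob a) => ehom a (sval x))
               (exist _ a erefl);
  ec_cmp : forall a b b',
    ecmp (ec_ob a) b b' ;; ec_lift a b' = lift2 ec_lift a b b' }.

(* Since [el_get] and [el_put] agree on objects, the sum over the fiber of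
   [el_get] is taken over the fiber of [el_put]. *)
Record elens (A B : ecat) := ELens {
  el_get : efunctor A B;
  el_put : ecofunctor A B;
  el_ob : forall a, el_get a = el_put a;
  el_putget : forall a b,
    ecast_dom b (el_ob a) ;; ec_lift el_put a b ;;
      ccopair (fun x : fiber el_put b =>
        ef_hom el_get a (sval x) ;;
        ecast_cod (el_get a) (etrans (el_ob (sval x)) (proj2_sig x))) =
    vid (ehom (el_get a) b) }.

End Enriched.

Record category := Category {
  cob :> Type;
  chom : cob -> cob -> Type;
  cstr : cat_struct chom }.

Definition cidm (C : category) (x : C) : chom x x := idm (cstr C) x.
Definition ccmp (C : category) (x y z : C) (f : chom x y) (g : chom y z) :
  chom x z := cmp (cstr C) f g.

Definition cast_dom (C : category) (x x' y : C) (e : x = x') (u : chom x y) :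
  chom x' y := ecast z (chom z y) e u.
Definition cast_cod (C : category) (x y y' : C) (e : y = y') (u : chom x y) :
  chom x y' := ecast z (chom x z) e u.

Record functor (A B : category) := Functor {
  f_ob :> A -> B;
  f_hom : forall a a', chom a a' -> chom (f_ob a) (f_ob a');
  f_id : forall a, f_hom (cidm a) = cidm (f_ob a);
  f_cmp : forall a a' a'' (u : chom a a') (v : chom a' a''),
    f_hom (ccmp u v) = ccmp (f_hom u) (f_hom v) }.

(* An element of [lift_set P a b] is a morphism out of [a] whose codomain is
   mapped to [b] by [P]. *)
Definition lift_set (A B : category) (P : A -> B) (a : A) (b : B) : Type :=
  {x : fiber P b & chom a (sval x)}.

Section LiftSet.
Variables (A B : category) (P : A -> B) (a : A) (b : B).
Definition lift_cod (w : lift_set P a b) : A := sval (tag w).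
Definition lift_codP (w : lift_set P a b) : P (lift_cod w) = b := proj2_sig (tag w).
Definition lift_mor (w : lift_set P a b) : chom a (lift_cod w) := tagged w.
End LiftSet.

Definition mk_lift (A B : category) (P : A -> B) (a : A) (b : B) (x : A)
    (e : P x = b) (w : chom a x) : lift_set P a b :=
  existT (fun x : fiber P b => chom a (sval x)) (exist _ x e) w.

Record cofunctor (A B : category) := Cofunctor {
  c_ob :> A -> B;
  c_lift : forall a b, chom (c_ob a) b -> lift_set c_ob a b;
  c_id : forall a, c_lift (cidm (c_ob a)) = mk_lift erefl (cidm a);
  c_cmp : forall a b b' (u : chom (c_ob a) b) (v : chom b b'),
    let w := c_lift u in
    let w' := c_lift (cast_dom (esym (lift_codP w)) v) in
    c_lift (ccmp u v) =
    mk_lift (lift_codP w') (ccmp (lift_mor w) (lift_mor w')) }.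

Record delta_lens (A B : category) := DeltaLens {
  dl_get : functor A B;
  dl_put : cofunctor A B;
  dl_ob : forall a, dl_get a = dl_put a;
  dl_putget : forall a b (u : chom (dl_put a) b),
    let w := c_lift u in
    cast_dom (dl_ob a)
      (cast_cod (etrans (dl_ob (lift_cod w)) (lift_codP w))
        (f_hom dl_get (lift_mor w))) = u }.

Section Weights.
Variable R : realType.
Local Open Scope ereal_scope.

Definition weight := {x : \bar R | 0 <= x}.

Definition wzero : weight := exist _ 0 (lexx 0).
Definition wadd (x y : weight) : weight :=
  exist _ (val x + val y) (adde_ge0 (valP x) (valP y)).
Definition wle (x y : weight) : bool := val x <= val y.

Lemma wle_refl x : wle x x.
Proof. exact: lexx. Qed.

Lemma wle_trans x y z : wle x y -> wle y z -> wle x z.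
Proof. exact: le_trans. Qed.

Lemma wle_add x x' y y' : wle x x' -> wle y y' -> wle (wadd x y) (wadd x' y').
Proof. exact: leeD. Qed.

Lemma waddA x y z : wadd x (wadd y z) = wadd (wadd x y) z.
Proof. by apply: val_inj; rewrite /= addeA. Qed.

Lemma wadd0w x : wadd wzero x = x.
Proof. by apply: val_inj; rewrite /= add0e. Qed.

Lemma waddw0 x : wadd x wzero = x.
Proof. by apply: val_inj; rewrite /= adde0. Qed.

Record wset := WSet { wcar :> Type; wgt : wcar -> weight }.

Record wmap (J K : wset) := WMap {
  wfun :> J -> K;
  wfunP : forall j, wle (wgt (wfun j)) (wgt j) }.

Lemma wmap_ext (J K : wset) (f g : wmap J K) : f =1 g -> f = g.
Proof.
case: f g => f fP [g gP] /= /funext fg.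
by case: g / fg gP => gP; rewrite (Prop_irrelevance fP gP).
Qed.

Definition wmap_id (J : wset) : wmap J J := WMap (fun j => wle_refl (wgt j)).
Definition wmap_cmp (J K L : wset) (f : wmap J K) (g : wmap K L) : wmap J L :=
  @WMap J L (fun j => g (f j)) (fun j => wle_trans (wfunP g (f j)) (wfunP f j)).

Definition wmap_cat_struct : cat_struct wmap.
Proof.
by apply: (@CatStruct _ _ wmap_id wmap_cmp) => *; apply: wmap_ext.
Defined.

Definition wset_cat : precat := PreCat wmap_cat_struct.

Definition wtens (J K : wset) : wset :=
  @WSet (J * K) (fun p => wadd (wgt p.1) (wgt p.2)).

Definition wtensm (J J' K K' : wset) (f : wmap J J') (g : wmap K K') :
  wmap (wtens J K) (wtens J' K') :=
  @WMap (wtens J K) (wtens J' K') (fun p => (f p.1, g p.2))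
    (fun p => wle_add (wfunP f p.1) (wfunP g p.2)).

Definition wunit : wset := @WSet unit (fun=> wzero).

Lemma wle_eq x y : x = y -> wle x y.
Proof. by move->; apply: wle_refl. Qed.

Definition wassoc (J K L : wset) :
  wmap (wtens (wtens J K) L) (wtens J (wtens K L)) :=
  @WMap (wtens (wtens J K) L) (wtens J (wtens K L))
    (fun p => (p.1.1, (p.1.2, p.2))) (fun p => wle_eq (waddA _ _ _)).
Definition wassocV (J K L : wset) :
  wmap (wtens J (wtens K L)) (wtens (wtens J K) L) :=
  @WMap (wtens J (wtens K L)) (wtens (wtens J K) L)
    (fun p => ((p.1, p.2.1), p.2.2)) (fun p => wle_eq (esym (waddA _ _ _))).
Definition wlunit (J : wset) : wmap (wtens wunit J) J :=
  @WMap (wtens wunit J) J snd (fun p => wle_eq (esym (wadd0w _))).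
Definition wlunitV (J : wset) : wmap J (wtens wunit J) :=
  @WMap J (wtens wunit J) (fun j => (tt, j)) (fun j => wle_eq (wadd0w _)).
Definition wrunit (J : wset) : wmap (wtens J wunit) J :=
  @WMap (wtens J wunit) J fst (fun p => wle_eq (esym (waddw0 _))).
Definition wrunitV (J : wset) : wmap J (wtens J wunit) :=
  @WMap J (wtens J wunit) (fun j => (j, tt)) (fun j => wle_eq (waddw0 _)).

Definition wset_monoidal : monoidal_struct wset_cat.
Proof.
apply: (@MonoidalStruct wset_cat wtens wtensm wunit wassoc wassocV
  wlunit wlunitV wrunit wrunitV).
- by move=> J K; apply: wmap_ext => -[].
- by move=> *; apply: wmap_ext.
- by move=> J K L; split; [apply: wmap_ext => -[[]]|apply: wmap_ext => -[? []]].
- by move=> J; split; [apply: wmap_ext => -[[]]|apply: wmap_ext].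
- by move=> J; split; [apply: wmap_ext => -[? []]|apply: wmap_ext].
- by move=> *; apply: wmap_ext.
- by move=> *; apply: wmap_ext.
- by move=> *; apply: wmap_ext.
- by move=> *; apply: wmap_ext.
- by move=> *; apply: wmap_ext.
Defined.

Definition wsum (I : Type) (X : I -> wset) : wset :=
  @WSet {i : I & X i} (fun p => wgt (tagged p)).
Definition winj (I : Type) (X : I -> wset) (i : I) : wmap (X i) (wsum X) :=
  @WMap (X i) (wsum X) (fun x => existT (fun i => wcar (X i)) i x)
    (fun x => wle_refl _).
Definition wcopair (I : Type) (X : I -> wset) (K : wset)
    (f : forall i, wmap (X i) K) : wmap (wsum X) K :=
  @WMap (wsum X) K (fun p => f (tag p) (tagged p))
    (fun p => wfunP (f (tag p)) (tagged p)).

Definition wset_coprod : coprod_struct wset_cat.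
Proof.
apply: (@CoprodStruct wset_cat wsum winj wcopair).
- by move=> *; apply: wmap_ext.
- by move=> I X K f g fg; apply: wmap_ext => -[i x]; rewrite /= -fg.
Defined.

Definition wdistl (I : Type) (X : I -> wset) (K : wset) :
  wmap (wtens (wsum X) K) (wsum (fun i => wtens (X i) K)) :=
  @WMap (wtens (wsum X) K) (wsum (fun i => wtens (X i) K))
    (fun p => existT (fun i => wcar (wtens (X i) K))
                (tag p.1) (tagged p.1, p.2))
    (fun p => wle_refl _).
Definition wdistr (I : Type) (K : wset) (X : I -> wset) :
  wmap (wtens K (wsum X)) (wsum (fun i => wtens K (X i))) :=
  @WMap (wtens K (wsum X)) (wsum (fun i => wtens K (X i)))
    (fun p => existT (fun i => wcar (wtens K (X i)))
                (tag p.2) (p.1, tagged p.2))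
    (fun p => wle_refl _).

Definition wSet : distr_moncat.
Proof.
apply: (@DistrMonCat wset_cat wset_monoidal wset_coprod wdistl wdistr).
- by move=> I X K; split; [apply: wmap_ext => -[[]]|apply: wmap_ext => -[? []]].
- by move=> I X K; split; apply: wmap_ext => -[? []].
Defined.

Definition wapp (J K : wSet) (f : vhom J K) : wcar J -> wcar K :=
  wfun (f : wmap J K).

Lemma wapp_eq (J K : wSet) (f g : vhom J K) : f = g -> wapp f =1 wapp g.
Proof. by move->. Qed.

Record weighted_cat := WeightedCat {
  wc_cat :> category;
  wc_wgt : forall x y : wc_cat, chom x y -> weight;
  wc_id : forall x : wc_cat, wle (wc_wgt (cidm x)) wzero;
  wc_cmp : forall (x y z : wc_cat) (u : chom x y) (v : chom y z),
    wle (wc_wgt (ccmp u v)) (wadd (wc_wgt u) (wc_wgt v)) }.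

Record weighted_lens (A B : weighted_cat) := WeightedLens {
  wl_lens :> delta_lens A B;
  wl_get : forall (a a' : A) (w : chom a a'),
    wle (wc_wgt (f_hom (dl_get wl_lens) w)) (wc_wgt w);
  wl_put : forall (a : A) (b : B) (u : chom (dl_put wl_lens a) b),
    wle (wc_wgt (lift_mor (c_lift u))) (wc_wgt u) }.

(* A wSet-category and the corresponding weighted category have the same
   objects, the same hom-sets and weights, and the same composites; the
   identity of [x] is the element picked out by the map [eid x] from the unit. *)
Section CatOfEcat.
Variable A : ecat wSet.

Definition ecat_hom (x y : A) : Type := wcar (ehom x y).
Definition ecat_id (x : A) : ecat_hom x x := wapp (eid x) tt.
Definition ecat_cmp (x y z : A) (u : ecat_hom x y) (v : ecat_hom y z) :
  ecat_hom x z := wapp (ecmp x y z) (u, v).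

Lemma ecat_cmp1m x y (f : ecat_hom x y) : ecat_cmp (ecat_id x) f = f.
Proof. exact: (wapp_eq (ecmp1m x y) (tt, f)). Qed.

Lemma ecat_cmpm1 x y (f : ecat_hom x y) : ecat_cmp f (ecat_id y) = f.
Proof. exact: (wapp_eq (ecmpm1 x y) (f, tt)). Qed.

Lemma ecat_cmpA x y z t (f : ecat_hom x y) (g : ecat_hom y z)
  (h : ecat_hom z t) : ecat_cmp f (ecat_cmp g h) = ecat_cmp (ecat_cmp f g) h.
Proof.
exact: esym (wapp_eq (ecmpA x y z t) (f, g, h)).
Qed.

Definition cat_of_ecat : category := Category (CatStruct ecat_cmp1m ecat_cmpm1 ecat_cmpA).

Definition wcat_of_ecat : weighted_cat :=
  @WeightedCat cat_of_ecat (fun x y u => wgt (u : ehom x y))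
    (fun x => wfunP (eid x) tt)
    (fun x y z u v => wfunP (ecmp x y z) (u, v)).

End CatOfEcat.

Lemma wapp_ecast_dom (B : ecat wSet) (b b' c : B) (e : b = b') u :
  wapp (ecast_dom c e) u = @cast_dom (wcat_of_ecat B) b b' c e u.
Proof. by case: b' / e. Qed.

Lemma wapp_ecast_cod (B : ecat wSet) (b c c' : B) (e : c = c') u :
  wapp (ecast_cod b e) u = @cast_cod (wcat_of_ecat B) b c c' e u.
Proof. by case: c' / e. Qed.

Section LensOfElens.
Variables A B : ecat wSet.
Let A' := wcat_of_ecat A.
Let B' := wcat_of_ecat B.

Section Functor.
Variable F : efunctor A B.

Definition efunctor_hom (a a' : A') (w : chom a a') :
  @chom B' (ef_ob F a) (ef_ob F a') := wapp (ef_hom F a a') w.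

Lemma efunctor_hom_id a : efunctor_hom (cidm a) = cidm (ef_ob F a : B').
Proof. exact: (wapp_eq (ef_id F a) tt). Qed.

Lemma efunctor_hom_cmp (a a' a'' : A') (u : chom a a') (v : chom a' a'') :
  efunctor_hom (ccmp u v) = ccmp (efunctor_hom u) (efunctor_hom v).
Proof. exact: (wapp_eq (ef_cmp F a a' a'') (u, v)). Qed.

Definition functor_of_efunctor : functor A' B' :=
  Functor efunctor_hom_id efunctor_hom_cmp.

End Functor.

Section Cofunctor.
Variable P : ecofunctor A B.

Definition ecofunctor_lift (a : A') (b : B') (u : @chom B' (ec_ob P a) b) :
  @lift_set A' B' (ec_ob P) a b := wapp (ec_lift P a b) u.

Lemma ecofunctor_lift_id (a : A') :
  @ecofunctor_lift a (ec_ob P a) (cidm _) = mk_lift erefl (cidm a).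
Proof. exact: (wapp_eq (ec_id P a) tt). Qed.

Lemma ecofunctor_lift_cmp (a : A') (b b' : B') (u : @chom B' (ec_ob P a) b)
    (v : chom b b') :
  let w := ecofunctor_lift u in
  let w' := ecofunctor_lift (cast_dom (esym (lift_codP w)) v) in
  ecofunctor_lift (ccmp u v) =
  mk_lift (lift_codP w') (ccmp (lift_mor w) (lift_mor w')).
Proof.
move=> w w'; rewrite {}/w' -wapp_ecast_dom.
apply: etrans (wapp_eq (ec_cmp P a b b') (u, v)) _.
rewrite /ecofunctor_lift -/w /mk_lift /lift_codP /lift_mor /lift_cod.
change (wapp (lift2 (ec_lift P) a b b') (u, v)) with
  (let w0 := wapp (ec_lift P a b) u in
   let w1 := wapp (ec_lift P (sval (tag w0)) b')
               (wapp (ecast_dom b' (esym (proj2_sig (tag w0)))) v) in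
   existT (fun y : fiber (ec_ob P) b' => wcar (ehom a (sval y))) (tag w1)
     (ecat_cmp (tagged w0) (tagged w1))).
rewrite /= -/(ecofunctor_lift u) -/w.
by case: (wapp (ec_lift P (sval (tag w)) b') _) => -[y yP] w1.
Qed.

Definition cofunctor_of_ecofunctor : cofunctor A' B' :=
  Cofunctor ecofunctor_lift_id ecofunctor_lift_cmp.

End Cofunctor.

Section Lens.
Variable L : elens A B.
Let F := functor_of_efunctor (el_get L).
Let P := cofunctor_of_ecofunctor (el_put L).

Lemma elens_ob (a : A') : F a = P a.
Proof. exact: (el_ob L a). Qed.

Lemma elens_putget (a : A') (b : B') (u : chom (P a) b) :
  let w := c_lift u in
  cast_dom (elens_ob a)
    (cast_cod (etrans (elens_ob (lift_cod w)) (lift_codP w))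
      (f_hom F (lift_mor w))) = u.
Proof.
move=> w; set e := elens_ob a.
have castK : cast_dom e (cast_dom (esym e) u) = u.
  by clear w; case: _ / e u => u.
rewrite -[RHS]castK; congr cast_dom.
have := wapp_eq (el_putget L a b) (cast_dom (esym e) u).
change (wapp (vid (ehom (el_get L a) b))) with
  (@id (@chom B' (el_get L a) b)) => /= <-.
set u' := cast_dom (esym e) u in castK *.
have {}castK : wapp (ecast_dom b (el_ob L a)) u' = u.
  by rewrite wapp_ecast_dom -[RHS]castK (Prop_irrelevance (el_ob L a) e).
rewrite (_ : w = wapp (ec_lift (el_put L) a b)
     (wapp (ecast_dom b (el_ob L a)) u')); last by rewrite castK.
apply: etrans (esym (@wapp_ecast_cod B _ _ _ _ _)) _.
by congr (wapp (ecast_cod _ _) _); apply: Prop_irrelevance.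
Qed.

Definition delta_lens_of_elens : delta_lens A' B' := DeltaLens elens_putget.

Definition wlens_of_elens : weighted_lens A' B' :=
  @WeightedLens A' B' delta_lens_of_elens
    (fun a a' w => wfunP (ef_hom (el_get L) a a') w)
    (fun a b u => wfunP (ec_lift (el_put L) a b) u).

End Lens.

End LensOfElens.

End Weights.

(* Main.v *)
Require Import Defs.
From mathcomp Require Import all_boot reals boolp.

(* A morphism of weighted sets is a function together with a proof of an
   inequality, so a wSet-category (or lens) and the corresponding weighted
   category (or lens) carry the same functions. The inverse passages rearrange
   this data; by function extensionality and proof irrelevance, the round trips
   are identities. *)

Set Implicit Arguments.
Unset Strict Implicit.
Unset Printing Implicit Defensive.

Local Open Scope moncat_scope.

Lemma CatStruct_eq (O : Type) (H : O -> O -> Type) (s t : cat_struct H) :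
  idm s = idm t -> cmp s = cmp t -> s = t.
Proof.
case: s t => i m a b c [i' m' a' b' c'] /= ei em.
case: i' / ei a' b' c' => a' b' c'; case: m' / em a' b' c' => a' b' c'.
by rewrite (Prop_irrelevance a a') (Prop_irrelevance b b')
  (Prop_irrelevance c c').
Qed.

(** Objects and hom-objects are shared on the nose, as they are after the round trip, so no
    transport along an equality of object sets is needed. *)
Lemma ECat_eq (V : distr_moncat) (O : Type) (H : O -> O -> V) i i'
    (m m' : forall x y z, vhom (H x y \ox H y z) (H x z)) a a' b b' c c' :
  i = i' -> m = m' -> @ECat V O H i m a b c = @ECat V O H i' m' a' b' c'.
Proof.
move=> ei em; case: i' / ei a' b' => a' b'.
case: m' / em a' b' c' => a' b' c'.
by rewrite (Prop_irrelevance a a') (Prop_irrelevance b b')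
  (Prop_irrelevance c c').
Qed.

Lemma EFunctor_eq (V : distr_moncat) (A B : ecat V) (f : A -> B)
    (h h' : forall a a', vhom (ehom a a') (ehom (f a) (f a'))) p p' q q' :
  h = h' -> @EFunctor V A B f h p q = @EFunctor V A B f h' p' q'.
Proof.
move=> e; case: h' / e p' q' => p' q'.
by rewrite (Prop_irrelevance p p') (Prop_irrelevance q q').
Qed.

Lemma ECofunctor_eq (V : distr_moncat) (A B : ecat V) (f : A -> B)
    (h h' : forall a b, vhom (ehom (f a) b) (lift_obj f a b)) p p' q q' :
  h = h' -> @ECofunctor V A B f h p q = @ECofunctor V A B f h' p' q'.
Proof.
move=> e; case: h' / e p' q' => p' q'.
by rewrite (Prop_irrelevance p p') (Prop_irrelevance q q').
Qed.

(** The type of [el_putget] contains casts along [el_ob], so the object equations must be identified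
    before the put-get laws can be compared. *)
Lemma ELens_eq (V : distr_moncat) (A B : ecat V) (L M : elens A B) :
  el_get L = el_get M -> el_put L = el_put M -> L = M.
Proof.
case: L M => F P o q [F' P' o' q'] /= eF eP.
case: F' / eF o' q' => o'; case: P' / eP o' => o'.
case: o' / (Prop_irrelevance o o') => q'.
by rewrite (Prop_irrelevance q q').
Qed.

(** In the round trip through enriched lenses the functions come back convertible, so a single [h]
    suffices and only the proofs of the laws can differ. *)
Lemma Functor_eq (A B : category) (f : A -> B)
    (h : forall a a', chom a a' -> chom (f a) (f a')) p p' q q' :
  @Functor A B f h p q = @Functor A B f h p' q'.
Proof. by rewrite (Prop_irrelevance p p') (Prop_irrelevance q q'). Qed.

Lemma Cofunctor_eq (A B : category) (f : A -> B)
    (h : forall a b, chom (f a) b -> lift_set f a b) p p' q q' :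
  @Cofunctor A B f h p q = @Cofunctor A B f h p' q'.
Proof. by rewrite (Prop_irrelevance p p') (Prop_irrelevance q q'). Qed.

Section WeightedCatEquivalence.
Variable R : realType.

Section EcatOfWcat.
Variable W : weighted_cat R.

Definition wcat_hom (x y : W) : wSet R := WSet (@wc_wgt R W x y).
Definition wcat_eid (x : W) : vhom (dunit (wSet R)) (wcat_hom x x) :=
  @WMap R (wunit R) (wcat_hom x x) (fun=> cidm x) (fun=> wc_id x).
Definition wcat_ecmp (x y z : W) :
    vhom (wcat_hom x y \ox wcat_hom y z) (wcat_hom x z) :=
  @WMap R (wtens (wcat_hom x y) (wcat_hom y z)) (wcat_hom x z)
    (fun p => ccmp p.1 p.2) (fun p => wc_cmp p.1 p.2).

Definition ecat_of_wcat : ecat (wSet R).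
Proof.
apply: (@ECat _ W wcat_hom wcat_eid wcat_ecmp).
- by move=> x y; apply: wmap_ext => -[t f]; apply: cmp1m.
- by move=> x y; apply: wmap_ext => -[f t]; apply: cmpm1.
- by move=> x y z t; apply: wmap_ext => -[[f g] h]; apply: esym (cmpA _ _ _ _).
Defined.

End EcatOfWcat.

Lemma wcat_of_ecatK : cancel (@wcat_of_ecat R) ecat_of_wcat.
Proof.
move=> A; apply: (@ECat_eq _ A (@ehom _ A)).
  (* The round trip turns [eid x] into the constant map at its value on [tt], and precomposes [ecmp]
     with [p |-> (p.1, p.2)]. Neither [unit] nor [prod] has definitional eta, hence the case
     analysis on the argument. *)
  by apply: functional_extensionality_dep => x; apply: wmap_ext => -[].
do 3![apply: functional_extensionality_dep => ?].
by apply: wmap_ext => -[].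
Qed.

Lemma WeightedCat_eq (O : Type) (H : O -> O -> Type) (s t : cat_struct H)
    (w : forall x y, H x y -> weight R) p p' q q' :
  s = t ->
  @WeightedCat R (Category s) w p q = @WeightedCat R (Category t) w p' q'.
Proof.
move=> e; case: t / e p' q' => p' q'.
by rewrite (Prop_irrelevance p p') (Prop_irrelevance q q').
Qed.

Lemma ecat_of_wcatK : cancel ecat_of_wcat (@wcat_of_ecat R).
Proof.
move=> W.
apply: (@WeightedCat_eq W (@chom W) _ (cstr W) (@wc_wgt R W)).
(* In this direction, evaluation at [tt] and projections of explicit pairs reduce, so identities and
   composites agree by conversion. *)
exact: CatStruct_eq.
Qed.

Section ElensOfWlens.
Variables A B : ecat (wSet R).
Let A' := wcat_of_ecat A.
Let B' := wcat_of_ecat B.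
Variable L : weighted_lens A' B'.
Let F := dl_get L.
Let P := dl_put L.

Definition wlens_get_hom (a a' : A) :
    vhom (ehom a a') (ehom (f_ob F a : B) (f_ob F a' : B)) :=
  @WMap R (@ehom _ A a a') (@ehom _ B (f_ob F a) (f_ob F a'))
    (@f_hom _ _ F a a') (@wl_get _ _ _ L a a').

Definition efunctor_of_wlens : efunctor A B.
Proof.
apply: (@EFunctor _ A B (f_ob F) wlens_get_hom).
- by move=> a; apply: wmap_ext => -[]; apply: (f_id F).
- by move=> a a' a''; apply: wmap_ext => -[u v]; apply: (f_cmp F).
Defined.

Definition wlens_put_lift (a : A) (b : B) :
    vhom (ehom (c_ob P a : B) b) (lift_obj (c_ob P : A -> B) a b) :=
  @WMap R (@ehom _ B (c_ob P a) b) (@lift_obj _ A B (c_ob P) a b)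
    (@c_lift _ _ P a b) (@wl_put _ _ _ L a b).

(** At a pair [(u, v)] this is the composition law [c_cmp] of [P], once its cast of [v] is rewritten
    as the enriched cast [ecast_dom]. *)
Lemma wlens_put_lift_cmp (a : A) (b b' : B) :
  ecmp (c_ob P a : B) b b' ;; wlens_put_lift a b' =
  lift2 wlens_put_lift a b b'.
Proof.
apply: wmap_ext => -[u v].
have := @c_cmp _ _ P a b b' u v; cbv zeta; rewrite -wapp_ecast_dom => e.
apply: etrans e _; rewrite /mk_lift /lift_codP /lift_mor /lift_cod.
(* Elementwise, [lift2] lifts [u] to [w], lifts [v] along [w] and composes. *)
rewrite -[RHS]/(
  let w := @c_lift _ _ P a b u in
  let w' := @c_lift _ _ P (sval (tag w)) b'
              (wapp (ecast_dom b' (esym (proj2_sig (tag w)))) v) in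
  existT (fun y : fiber (c_ob P : A -> B) b' => wcar (ehom a (sval y)))
    (tag w') (@ecat_cmp R A _ _ _ (tagged w) (tagged w'))) /=.
(* One side repacks the fiber element of [w'] as an [exist]; [sig] has no definitional eta, so it is
   destructed. *)
by case: (@c_lift _ _ P (sval _) b' _) => -[y yP] w'.
Qed.

Definition ecofunctor_of_wlens : ecofunctor A B.
Proof.
apply: (@ECofunctor _ A B (c_ob P) wlens_put_lift).
- by move=> a; apply: wmap_ext => -[]; apply: (c_id P).
- exact: wlens_put_lift_cmp.
Defined.

Lemma wlens_putget (a : A) (b : B) :
  ecast_dom b (dl_ob L a : efunctor_of_wlens a = ecofunctor_of_wlens a) ;;
  ec_lift ecofunctor_of_wlens a b ;;
    ccopair (fun x : fiber ecofunctor_of_wlens b =>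
      ef_hom efunctor_of_wlens a (sval x) ;;
      ecast_cod (efunctor_of_wlens a)
        (etrans (dl_ob L (sval x)) (proj2_sig x))) =
  vid (ehom (efunctor_of_wlens a) b).
Proof.
apply: wmap_ext => u.
(* The enriched law casts the input of the put, the delta lens law the output of the get. Applying
   the injective cast to both sides reduces the former to [dl_putget] at the cast of [u]. *)
have castI : injective (@cast_dom B' _ _ b (dl_ob L a)).
  by case: _ / (dl_ob L a).
apply: castI; rewrite -[RHS](dl_putget _).
congr cast_dom; rewrite -wapp_ecast_dom.
exact: (@wapp_ecast_cod R B).
Qed.

Definition elens_of_wlens : elens A B := ELens wlens_putget.

End ElensOfWlens.

Lemma wlens_of_elensK (A B : ecat (wSet R)) :
  cancel (@wlens_of_elens R A B) (@elens_of_wlens A B).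
Proof.
move=> L; apply: ELens_eq.
(* By eta for primitive records, a [WMap] rebuilt from its own function and inequality is the
   original, so the components agree by conversion. *)
- exact: (@EFunctor_eq _ A B (ef_ob (el_get L))).
- exact: (@ECofunctor_eq _ A B (ec_ob (el_put L))).
Qed.

Lemma WeightedLens_eq (A B : weighted_cat R) (L M : weighted_lens A B) :
  dl_get L = dl_get M -> dl_put L = dl_put M -> L = M.
Proof.
case: L M => -[F P o q] g p [[F' P' o' q'] g' p'] /= eF eP.
case: F' / eF o' q' g' p' => o' q' g' p'.
case: P' / eP o' q' g' p' => o' q' g' p'.
case: o' / (Prop_irrelevance o o') q' g' p' => q' g' p'.
case: q' / (Prop_irrelevance q q') g' p' => g' p'.
by rewrite (Prop_irrelevance g g') (Prop_irrelevance p p').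
Qed.

Lemma elens_of_wlensK (A B : ecat (wSet R)) :
  cancel (@elens_of_wlens A B) (@wlens_of_elens R A B).
Proof.
move=> L; apply: WeightedLens_eq.
- exact: (@Functor_eq _ _ (f_ob (dl_get L)) (@f_hom _ _ (dl_get L))).
- exact: (@Cofunctor_eq _ _ (c_ob (dl_put L)) (@c_lift _ _ (dl_put L))).
Qed.

End WeightedCatEquivalence.

Theorem mainTheorem4 (R : realType) :
  bijective (@wcat_of_ecat R) /\
  forall A B : ecat (wSet R), bijective (@wlens_of_elens R A B).
Proof.
split; first exact: Bijective (@wcat_of_ecatK R) (@ecat_of_wcatK R).
(* As [wcat_of_ecat] is bijective, letting [A] and [B] range over wSet-categories covers all pairs
   of weighted categories. *)
move=> A B.
exact: Bijective (@wlens_of_elensK R A B) (@elens_of_wlensK R A B).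
Qed.
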